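(* The integer $13$ is the smallest positive integer $n$ such that every permutation $p\in S_n$ has a $4$-additive subsequence of length three.
   Context: $S_n$ denotes the set of permutations of $\{1,2,\ldots,n\}$ written in one-line notation $p=(p_1,p_2,\ldots,p_n)$. A subsequence of $p$ of length $k$ is a sequence $(p_{i_1},\ldots,p_{i_k})$ with $i_1<\cdots<i_k$. A sequence $(a_1,a_2,\ldots,a_k)$ of positive integers is $\ell$-additive if $a_1+a_2+\cdots+a_k=\ell a_1$ or $a_1+a_2+\cdots+a_k=\ell a_k$. *)

(* Defs.v *)
From mathcomp Require Import all_boot all_fingroup.

Set Implicit Arguments.
Unset Strict Implicit.
Unset Printing Implicit Defensive.

(* 'S_n permutes {0, ..., n-1}; the one-line notation is shifted by one so that
   its entries are 1, ..., n (additivity is not shift-invariant). *)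
Definition one_line (n : nat) (p : 'S_n) : seq nat :=
  [seq (p i).+1 | i <- enum 'I_n].

Definition additive_seq (l : nat) (s : seq nat) : bool :=
  if s is a1 :: s' then
    (sumn s == l * a1) || (sumn s == l * last a1 s')
  else false.

Definition has_additive_subseq (l k n : nat) (p : 'S_n) : Prop :=
  exists s : seq nat,
    [/\ subseq s (one_line p), size s = k & additive_seq l s].

(* Main.v *)
Require Import Defs.
From mathcomp Require Import all_boot all_fingroup.
From mathcomp Require Import zify.

(** A triple is 4-additive exactly when one of its two extreme terms, say [z],
    is a third of the sum of the other two. So for distinct entries [x], [y],
    [z] with [x + y = 3 * z], a permutation without 4-additive subsequence of
    length three has to place [z] strictly between [x] and [y]
    ([additive_triple_or_between]). Each such condition ties the relative order
    of [x] and [z] to that of [z] and [y], and with [<] meaning precedence in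
    the permutation the conditions on the entries 3, ..., 9 and 13 chain up.
    Up to reversal, [4 < 5]. Then
    - [7 < 4] (from 5 + 7 = 3 * 4), so [7 < 5], so [5 < 8] (7 + 8 = 3 * 5), so
      [7 < 8], so [13 < 7] (8 + 13 = 3 * 7), so [13 < 5];
    - hence [6 < 5] (5 + 13 = 3 * 6), so [5 < 9] (6 + 9 = 3 * 5), so [4 < 9],
      so [3 < 4] (3 + 9 = 3 * 4);
    - but then 3 precedes both 4 and 5, whereas 4 + 5 = 3 * 3.

    For the lower bound, [avoider12] is a permutation of 1, ..., 12 without
    4-additive triple. Deleting its entries above [n] creates no new
    subsequence, so it yields an example in every smaller symmetric group. *)

Set Implicit Arguments.
Unset Strict Implicit.
Unset Printing Implicit Defensive.

(** * Enumerating subsequences *)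

Fixpoint subseqs (T : Type) (s : seq T) : seq (seq T) :=
  if s is x :: s' then map (cons x) (subseqs s') ++ subseqs s' else [:: [::]].

Lemma mem_subseqs (T : eqType) (s t : seq T) : (t \in subseqs s) = subseq t s.
Proof.
elim: s t => [|x s IHs] [|y t] //=; rewrite mem_cat IHs ?sub0seq ?orbT //.
case: eqP => [->|neq_yx].
  rewrite mem_map => [|u v []] //; rewrite IHs.
  by apply/orb_idr/subseq_trans/subseq_cons.
by case: mapP => // -[u _ [/neq_yx]].
Qed.

(** Existence of an additive subsequence as a boolean: it can be refuted by
    computation on a concrete sequence, and proved by contradiction without
    classical axioms. *)
Definition additive_subseq (l k : nat) (s : seq nat) : bool :=
  has (fun t => (size t == k) && additive_seq l t) (subseqs s).

Lemma additive_subseqP (l k : nat) (s : seq nat) :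
  reflect (exists t, [/\ subseq t s, size t = k & additive_seq l t])
          (additive_subseq l k s).
Proof.
apply: (iffP hasP) => [[t] | [t [sub_ts size_t add_t]]].
  by rewrite mem_subseqs => sub_ts /andP[/eqP size_t add_t]; exists t.
by exists t; rewrite ?mem_subseqs // size_t eqxx.
Qed.

Lemma subseq_map_nth (T : eqType) (x0 : T) (s : seq T) (js : seq nat) :
  sorted ltn js -> all (gtn (size s)) js -> subseq (map (nth x0 s) js) s.
Proof.
move=> sorted_js /allP lt_js.
rewrite -[in X in subseq _ X](mkseq_nth x0 s); apply: map_subseq.
(* Strictly increasing sequences with the same elements are equal. *)
suff -> : js = [seq j <- iota 0 (size s) | j \in js] by apply: filter_subseq.
apply: (irr_sorted_eq ltn_trans ltnn sorted_js).
  exact/(sorted_filter ltn_trans)/iota_ltn_sorted.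
move=> j; rewrite mem_filter mem_iota add0n /=.
by case: (boolP (j \in js)) => //= /lt_js.
Qed.

(** * Additive triples and betweenness *)

Lemma subseq_triple (T : eqType) (s : seq T) (x y z : T) :
  z \in s -> index x s < index y s < index z s -> subseq [:: x; y; z] s.
Proof.
move=> sz /andP[lt_xy lt_yz].
have lt_z : index z s < size s by rewrite index_mem.
have lt_y := ltn_trans lt_yz lt_z; have lt_x := ltn_trans lt_xy lt_y.
have := @subseq_map_nth _ x s [:: index x s; index y s; index z s].
rewrite /= lt_xy lt_yz lt_x lt_y lt_z !nth_index -?index_mem //.
exact.
Qed.

Definition between (q : nat -> nat) (x z y : nat) : bool :=
  (q x < q z < q y) || (q y < q z < q x).

(** If [z] comes before both [x] and [y], or after both, then the three entries
    in their order of appearance form a triple of sum [4 * z] having [z] at one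
    end. *)
Lemma additive_triple_or_between (s : seq nat) (x z y : nat) :
    x \in s -> z \in s -> y \in s -> uniq [:: x; z; y] -> x + y = 3 * z ->
  ~~ additive_subseq 4 3 s -> between (index^~ s) x z y.
Proof.
move=> sx sz sy; rewrite /= !inE negb_or => /andP[/andP[neq_xz neq_xy]].
rewrite andbT => neq_zy sum_xy; apply: contraR => not_between.
have triple a b c : c \in s -> index a s < index b s < index c s ->
    additive_seq 4 [:: a; b; c] -> additive_subseq 4 3 s.
  move=> sc lt_abc add_abc; apply/additive_subseqP.
  by exists [:: a; b; c]; split=> //; apply: subseq_triple.
have neq_index a b : a \in s -> b \in s -> a != b -> index a s != index b s.
  by move=> sa sb; apply: contraNneq => /(index_inj 0 sa sb) ->.
move: not_between (neq_index _ _ sx sz neq_xz) (neq_index _ _ sx sy neq_xy)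
  (neq_index _ _ sz sy neq_zy).
rewrite /between => not_between ne_xz ne_xy ne_zy.
have [lt_xy | le_yx] := ltnP (index x s) (index y s);
  have [lt_zx | le_xz] := ltnP (index z s) (index x s).
- by apply: (triple z x y) => //=; lia.
- by apply: (triple x y z) => //=; lia.
- by apply: (triple z y x) => //=; lia.
- by apply: (triple y x z) => //=; lia.
Qed.

(** Only eight of the thirteen entries matter: the seven betweenness conditions
    among them are contradictory in every order. *)
Lemma additive_subseq_4_3 (s : seq nat) :
  {subset [:: 3; 4; 5; 6; 7; 8; 9; 13] <= s} -> additive_subseq 4 3 s.
Proof.
move=> sub_s; apply: contraT => avoid_s.
have btw x z y := fun sx sz sy uniq_xzy sum_xy =>
  @additive_triple_or_between s x z y (sub_s x sx) (sub_s z sz) (sub_s y sy)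
    uniq_xzy sum_xy avoid_s.
have b547 := btw 5 4 7 isT isT isT isT erefl.
have b758 := btw 7 5 8 isT isT isT isT erefl.
have b8_7_13 := btw 8 7 13 isT isT isT isT erefl.
have b5_6_13 := btw 5 6 13 isT isT isT isT erefl.
have b659 := btw 6 5 9 isT isT isT isT erefl.
have b349 := btw 3 4 9 isT isT isT isT erefl.
have b435 := btw 4 3 5 isT isT isT isT erefl.
(* The orders [4 < 5] and [5 < 4] are mirror images; each is refuted by the
   chain of forced precedences 7-4-5, 7-5-8, 13-7-8, 13-6-5, 6-5-9, 3-4-9,
   which leaves 3 outside the interval from 4 to 5. *)
rewrite /between in b547 b758 b8_7_13 b5_6_13 b659 b349 b435; lia.
Qed.

(** * One-line notation *)

Lemma one_lineE (n : nat) (p : 'S_n) :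
  one_line p = [tuple tnth (iota_tuple n 1) (p i) | i < n].
Proof. by apply: eq_map => i; rewrite (tnth_nth 0) nth_iota. Qed.

Lemma one_lineP (n : nat) (s : seq nat) :
  reflect (exists p : 'S_n, one_line p = s) (perm_eq s (iota 1 n)).
Proof.
apply: (iffP (tuple_permP (t := iota_tuple n 1))) => -[p eq_s]; exists p;
  by rewrite ?one_lineE // -eq_s one_lineE.
Qed.

(** * A permutation of length twelve without additive triple *)

Definition avoider12 : seq nat := [:: 1; 9; 10; 7; 4; 3; 2; 5; 6; 8; 11; 12].

Lemma avoider12_avoids : ~~ additive_subseq 4 3 avoider12.
Proof. by vm_compute. Qed.

(** The entries at most [n], rather than a prefix, are kept, since these are
    the ones that form a permutation of 1, ..., [n]. *)
Lemma perm_avoider12_leq (n : nat) :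
  n <= 12 -> perm_eq [seq x <- avoider12 | x <= n] (iota 1 n).
Proof.
move=> le_n12; apply: uniq_perm; rewrite ?filter_uniq ?iota_uniq // => x.
have perm12 : perm_eq avoider12 (iota 1 12) by [].
by rewrite mem_filter (perm_mem perm12) !mem_iota; lia.
Qed.

Theorem proposition4p3 :
  [/\ 0 < 13,
      forall p : 'S_13, has_additive_subseq 4 3 p
    & forall n : nat, 0 < n ->
        (forall p : 'S_n, has_additive_subseq 4 3 p) -> 13 <= n].
Proof.
split=> // [p | n _ additive_n].
  apply/additive_subseqP/additive_subseq_4_3 => x.
  have /one_lineP/perm_mem -> : exists q : 'S_13, one_line q = one_line p.
    by exists p.
  by move: x; apply/allP.
rewrite ltnNge; apply/negP => le_n12.
have /one_lineP[p eq_p] := perm_avoider12_leq le_n12.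
have [t [sub_t size_t add_t]] := additive_n p.
case/negP: avoider12_avoids; apply/additive_subseqP; exists t; split=> //.
by apply: subseq_trans sub_t _; rewrite eq_p filter_subseq.
Qed.
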